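(* Let $\lambda>0$. For a fixed $P\in\mathcal{P}_2(\mathbb{R}^n)$, the minimizer $$Q^{*}=\arg\min_{Q\in\mathcal{P}_{2}(\mathbb{R}^{n})} C_{\lambda}(P,Q)$$ exists, and its density function can be written as $$dQ^{*}=dP\star\phi_{\lambda},$$ where $\phi_{\lambda}$ is the density function of $\mathcal{N}(0,\frac{\lambda}{2}I)$ on $\mathbb{R}^n$, and $\star$ denotes convolution (that is, if $p$ is the density of $P$, then $Q^*$ has density $q^*(y)=\int p(x)\phi_\lambda(y-x)\,dx$).
   Context: $\mathcal{P}_2(\mathbb{R}^n)$ is the set of all probability measures on $\mathbb{R}^n$ with finite second moment that are absolutely continuous with respect to Lebesgue measure. The entropy-regularized optimal transport cost is $$C_{\lambda}(P,Q)=\inf_{\pi\in\Pi(P,Q)}\int_{\mathbb{R}^{n}\times \mathbb{R}^{n}}\|x-y\|^2\,\pi(x,y)\,dx\,dy-\lambda\,\mathrm{Ent}(\pi),$$ where $\Pi(P,Q)$ is the set of couplings of $P$ and $Q$ (probability measures on $\mathbb{R}^n\times\mathbb{R}^n$ with marginals $P$ and $Q$), assumed absolutely continuous with respect to Lebesgue measure and identified with their densities $\pi(x,y)$, and $\mathrm{Ent}(\pi)=-\int\pi(x,y)\log\pi(x,y)\,dx\,dy$ is the Shannon entropy.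
   Formalization: Uniqueness of the minimizer is claimed only among minimizers of finite cost: if Ent(P) = -∞ (possible in P_2) then C_λ(P,·) is identically +∞ and every Q in P_2 is a minimizer; existence of a minimizer with density p⋆φ_λ is kept for all P. *)

(* Defs.v *)
From HB Require Import structures.
From mathcomp Require Import all_boot all_order all_algebra.
From mathcomp Require Import all_classical all_reals all_analysis.

Set Implicit Arguments.
Unset Strict Implicit.
Unset Printing Implicit Defensive.

Import Order.TTheory GRing.Theory Num.Theory.
Import numFieldNormedType.Exports.

Local Open Scope classical_set_scope.
Local Open Scope ring_scope.

(* The library equips tuples with the product sigma-algebra, which for Borel
   factors is the Borel sigma-algebra of R^n. *)
Notation Rn R n := (n.-tuple (measurableTypeR R)).

(* Restated because the library's sigma-finiteness instance of [\x] is not found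
   by unification: the one for finite measures is registered first. *)
Lemma product_sigma_finite d1 d2 (T1 : measurableType d1) (T2 : measurableType d2)
    (R : realType) (m1 : {sigma_finite_measure set T1 -> \bar R})
    (m2 : {sigma_finite_measure set T2 -> \bar R}) :
  sigma_finite setT (m1 \x m2)%E.
Proof.
have /sigma_finiteP[F [TF ndF Foo]] := sigma_finiteT m1.
have /sigma_finiteP[G [TG ndG Goo]] := sigma_finiteT m2.
exists (fun n => F n `*` G n).
  rewrite -setXTT TF TG predeqE => -[x y]; split.
    move=> [/= [n _ Fnx] [k _ Gky]]; exists (maxn n k) => //; split.
    - by move: x Fnx; exact/subsetPset/ndF/leq_maxl.
    - by move: y Gky; exact/subsetPset/ndG/leq_maxr.
  by move=> [n _ []/= ? ?]; split; exists n.
move=> k; have [? ?] := Foo k; have [? ?] := Goo k.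
split; first exact: measurableX.
by rewrite product_measure1E// lte_mul_pinfty// ge0_fin_numE.
Qed.

Section lebesgue_tuple.
Context (R : realType).
Local Open Scope ereal_scope.

Definition tcons n (x : measurableTypeR R * Rn R n) : Rn R n.+1 :=
  [the n.+1.-tuple _ of x.1 :: x.2].

Definition tuncons n (t : Rn R n.+1) : measurableTypeR R * Rn R n :=
  (tnth t ord0, [tuple of behead t]).

Lemma measurable_tcons n : measurable_fun setT (@tcons n).
Proof. by apply: measurable_cons; [exact: measurable_fst|exact: measurable_snd]. Qed.

Lemma measurable_tuncons n : measurable_fun setT (@tuncons n).
Proof.
by apply: measurable_fun_pair; [exact: measurable_tnth|exact: measurable_behead].
Qed.

Lemma tunconsK n : cancel (@tuncons n) (@tcons n).
Proof. by move=> t; rewrite [RHS]tuple_eta; exact: val_inj. Qed.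

Lemma tconsK n : cancel (@tcons n) (@tuncons n).
Proof. by move=> [x t]; congr pair; exact: val_inj. Qed.

Section step.
Context n (m : {sigma_finite_measure set (Rn R n) -> \bar R}).

Definition lebesgue_tupleS : set (Rn R n.+1) -> \bar R :=
  pushforward (@lebesgue_measure R \x m) (@tcons n).

Let mu0 : lebesgue_tupleS set0 = 0.
Proof. by rewrite /lebesgue_tupleS /pushforward preimage_set0 measure0. Qed.

Let mu_ge0 A : 0 <= lebesgue_tupleS A.
Proof. by rewrite /lebesgue_tupleS /pushforward measure_ge0. Qed.

Let mu_sigma : semi_sigma_additive lebesgue_tupleS.
Proof.
move=> F mF tF mUF; rewrite /lebesgue_tupleS /pushforward preimage_bigcup.
have mpre B : measurable B -> measurable (@tcons n @^-1` B).
  by move=> mB; rewrite -[X in measurable X]setTI; exact: measurable_tcons.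
apply: measure_semi_sigma_additive; first by move=> k; exact: mpre.
- apply/trivIsetP => /= i j _ _ ij; rewrite -preimage_setI.
  by move/trivIsetP : tF => /(_ _ _ _ _ ij) ->//; rewrite preimage_set0.
- by rewrite -preimage_bigcup; exact: mpre.
Qed.

HB.instance Definition _ := isMeasure.Build _ _ _ lebesgue_tupleS mu0 mu_ge0 mu_sigma.

Let mu_sfin : sigma_finite setT lebesgue_tupleS.
Proof.
have [F TF Foo] := product_sigma_finite (@lebesgue_measure R) m.
exists (fun k => @tuncons n @^-1` F k).
  by rewrite -preimage_bigcup -TF preimage_setT.
move=> k; have [mF Fk] := Foo k; split.
  by rewrite -[X in measurable X]setTI; exact: measurable_tuncons.
rewrite /lebesgue_tupleS /pushforward -comp_preimage.
rewrite (_ : _ \o _ = id) ?preimage_id//.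
by apply/funext => x; exact: tconsK.
Qed.

HB.instance Definition _ := Measure_isSigmaFinite.Build _ _ _ lebesgue_tupleS mu_sfin.

End step.

Fixpoint lebesgue_tuple n : {sigma_finite_measure set (Rn R n) -> \bar R} :=
  match n with
  | 0 => @dirac _ (Rn R 0) [tuple] R
  | k.+1 => lebesgue_tupleS (lebesgue_tuple k)
  end.

Lemma lebesgue_tuple_box n (A : 'I_n -> set (measurableTypeR R)) :
  (forall i, measurable (A i)) ->
  lebesgue_tuple n [set t | forall i, A i (tnth t i)] =
  \prod_(i < n) lebesgue_measure (A i).
Proof.
elim: n A => [|n IH] A mA.
  rewrite big_ord0 /= diracE; suff -> : [tuple] \in [set t : Rn R 0 | forall i, A i (tnth t i)] by [].
  by rewrite inE => -[].
rewrite big_ord_recl -IH//= /lebesgue_tupleS /pushforward.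
rewrite -product_measure1E//=; last first.
  rewrite (_ : mkset _ = \bigcap_(i in [set: 'I_n]) ((fun t => tnth t i) @^-1` A (lift ord0 i))).
    apply: fin_bigcap_measurable => // i _.
    by rewrite -[X in measurable X]setTI; exact: measurable_tnth.
  by apply/seteqP; split => t /= h i; [move=> _; exact: h|exact: h].
congr product_measure1; apply/seteqP; split => -[x t] /= h.
  split; first by have := h ord0; rewrite (tnth_nth x).
  by move=> i; have := h (lift ord0 i); rewrite tnthS.
move=> i; case: (unliftP ord0 i) => [j|] -> /=.
  by rewrite tnthS; exact: h.2.
exact: h.1.
Qed.

End lebesgue_tuple.

Section euclidean.
Context (R : realType) (n : nat).

Definition tsub (x y : Rn R n) : Rn R n := [tuple tnth x i - tnth y i | i < n].

(* the square of the Euclidean norm *)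
Definition sqnorm (x : Rn R n) : R := \sum_(i < n) tnth x i ^+ 2.

(* Density of the centred Gaussian N(0, v I), where v is the variance (not the
   standard deviation) of each coordinate: (2 pi v)^(-n/2) exp(-|z|^2/(2v)). *)
Definition gauss_pdf (v : R) (z : Rn R n) : R :=
  Num.sqrt (2 * pi * v) ^- n * expR (- (sqnorm z / (2 * v))).

Lemma gauss_pdf_prod (v : R) (z : Rn R n) : 0 < v ->
  gauss_pdf v z = \prod_(i < n) normal_pdf 0 (Num.sqrt v) (tnth z i).
Proof.
move=> v0; have s0 : Num.sqrt v != 0 by rewrite sqrtr_eq0 -ltNge.
under eq_bigr => i _.
  rewrite normal_pdfE// /normal_peak /normal_fun subr0 sqr_sqrtr ?ltW//.
  rewrite -mulr_natl -(mulr_natl v) [v * pi]mulrC mulrA mulNr.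
  over.
rewrite big_split/= prodr_const card_ord exprVn -expR_sum.
by rewrite /gauss_pdf /sqnorm mulr_suml sumrN.
Qed.

(* The convolution integral is taken in R; it is finite for every y as soon as
   p is integrable and f bounded and measurable. *)
Definition convolution (p f : Rn R n -> R) (y : Rn R n) : R :=
  (\int[lebesgue_tuple R n]_x (p x * f (tsub y x)))%R.

End euclidean.

Definition is_density d (T : measurableType d) (R : realType)
    (mu : set T -> \bar R) (f : T -> R) (m : set T -> \bar R) : Prop :=
  [/\ measurable_fun setT f, (forall x, 0 <= f x) &
      forall A, measurable A -> m A = (\int[mu]_(x in A) (f x)%:E)%E].

(* Here f ln f = 0 where f = 0, since ln 0 = 0 in the library. *)
Definition entropy d (T : measurableType d) (R : realType)
    (mu : set T -> \bar R) (f : T -> R) : \bar R :=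
  (- \int[mu]_x (f x * ln (f x))%:E)%E.

Section eot.
Context (R : realType) (n : nat).
Local Open Scope ereal_scope.
Implicit Types P Q : probability (Rn R n) R.

Definition lebesgue_tuple2 : {measure set (Rn R n * Rn R n)%type -> \bar R} :=
  lebesgue_tuple R n \x lebesgue_tuple R n.

Definition P2 P : Prop :=
  P `<< lebesgue_tuple R n /\ \int[P]_x (sqnorm x)%:E < +oo.

(* Marginals are compared on measurable sets only: the value of a measure on a
   non-measurable set carries no information. *)
Definition is_coupling P Q (pi : probability (Rn R n * Rn R n)%type R) : Prop :=
  forall A, measurable A ->
    pushforward pi fst A = P A /\ pushforward pi snd A = Q A.

(* For P and Q in P2 the transport term is finite and the entropy is < +oo, so
   the difference is never of the form oo - oo; it is +oo if the entropy is
   -oo. *)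
Definition eot_objective (lam : R) (f : Rn R n * Rn R n -> R) : \bar R :=
  \int[lebesgue_tuple2]_z (sqnorm (tsub z.1 z.2) * f z)%:E
  - lam%:E * entropy lebesgue_tuple2 f.

Definition eot_cost (lam : R) P Q : \bar R :=
  ereal_inf [set c | exists (pi : probability (Rn R n * Rn R n)%type R)
                            (f : Rn R n * Rn R n -> R),
    [/\ is_coupling P Q pi, is_density lebesgue_tuple2 f pi &
        c = eot_objective lam f]].

Definition is_eot_argmin (lam : R) P Q : Prop :=
  P2 Q /\ forall Q', P2 Q' -> eot_cost lam P Q <= eot_cost lam P Q'.

End eot.

(* Main.v *)
Require Import Defs.
From HB Require Import structures.
From mathcomp Require Import all_boot all_order all_algebra.
From mathcomp Require Import all_classical all_reals all_analysis.
From mathcomp Require Import measurable_realfun ring lra.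

Set Implicit Arguments.
Unset Strict Implicit.
Unset Printing Implicit Defensive.

Import Order.TTheory GRing.Theory Num.Theory.
Import numFieldNormedType.Exports.

Local Open Scope classical_set_scope.
Local Open Scope ring_scope.

(** Let [p] be a density of [P], [phi] the density of N(0, lam/2 I), and let
    [g (x, y) = p x * phi (y - x)] be the joint density of a vector of law [P] and
    its sum with an independent vector of density [phi]. Since
    [ln phi (y - x)] is a constant minus [|x - y|^2 / lam], the objective of a
    coupling [pi] of [P] with density [f] is, up to a constant depending only
    on [P] and [lam], equal to [lam] times the relative entropy of [f] with
    respect to [g]. This is minimal for [f = g], whose second marginal is the
    convolution of [p] and [phi].

    Since integrals may be infinite, the relative entropy itself is never
    formed. It is replaced by its variational lower bound: for every bounded
    [t] and [X = g e^t / f], the inequality [1 + w <= e^w] at [w = ln X] reads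
    [ln p (x) + (ln phi (y - x) + t + 1 - X) <= ln f] and the integral of [X]
    against [pi] is at most the integral of [g e^t]. The bracket is integrable
    and the negative part of [ln p] is [P]-integrable thanks to the second
    moment of [P] (by the same inequality with a Gaussian reference density),
    so integrating is legitimate as soon as the objective is not [+oo]
    ([integral_sandwich]). With [t = s * \1_A y] this yields
    [eot_objective_ge]: the objective exceeds its value at [g] by at least
    [lam * (s * Q' A - (e^s - 1) * Q A)].

    For [s = 0] this is the minimality of [Q]. The bound depends on [f] only
    through its second marginal [Q'], so it holds for the cost of [Q'] itself,
    whether or not the infimum over couplings is attained; if [Q'] is also a
    minimizer, then [s * Q' A <= (e^s - 1) * Q A] for every real [s], and
    comparing the slopes at [s = 0] gives [Q' A = Q A]. When [P] has entropy
    [-oo], every objective is [+oo] and every admissible [Q'] is a minimizer. *)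

(** * Integrals of functions bounded below *)
Section integral_sandwich.
Context d (T : measurableType d) (R : realType).
Variable m : {measure set T -> \bar R}.
Local Open Scope ereal_scope.

Lemma ae_le_integral (u v : T -> \bar R) :
  m.-integrable setT u -> m.-integrable setT v ->
  {ae m, forall x, u x <= v x} -> \int[m]_x u x <= \int[m]_x v x.
Proof.
move=> iu iv uv.
have mu := measurable_int _ iu; have mv := measurable_int _ iv.
rewrite integralE [leRHS]integralE; apply: leeB.
  apply: ae_ge0_le_integral => //.
  - exact: measurable_funepos.
  - exact: measurable_funepos.
  - by apply: filterS uv => x uvx _; rewrite !funeposE ge_max !le_max uvx lexx orbT.
apply: ae_ge0_le_integral => //.
- exact: measurable_funeneg.
- exact: measurable_funeneg.
- apply: filterS uv => x uvx _.
  by rewrite !funenegE ge_max !le_max leeN2 uvx lexx orbT.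
Qed.

Lemma integrable_funeposneg (u : T -> \bar R) : measurable_fun setT u ->
  \int[m]_x u^\+ x < +oo -> \int[m]_x u^\- x < +oo -> m.-integrable setT u.
Proof.
move=> mu up un; apply/integrableP; split => //.
under eq_integral do rewrite -/((abse \o u) _) fune_abse.
rewrite ge0_integralD//; first by rewrite lte_add_pinfty.
- exact: measurable_funepos.
- exact: measurable_funeneg.
Qed.

(** Here [v] may a priori have integral [-oo] and [a] may a priori have integral
    [+oo]. The negative part of [v] is controlled by that of [a] and by [r];
    once [v] is integrable, the positive part of [a] is controlled by that of
    [v] and by [r]. *)
Lemma integral_sandwich (a r v : T -> R) :
  measurable_fun setT a -> measurable_fun setT v ->
  m.-integrable setT (EFin \o r) ->
  \int[m]_x (EFin \o a)^\- x < +oo ->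
  \int[m]_x (v x)%:E < +oo ->
  {ae m, forall x, (a x + r x <= v x)%R} ->
  [/\ m.-integrable setT (EFin \o a), m.-integrable setT (EFin \o v) &
      \int[m]_x (a x)%:E + \int[m]_x (r x)%:E <= \int[m]_x (v x)%:E].
Proof.
move=> ma mv ir an vlt arv.
have mEa : measurable_fun setT (EFin \o a) by exact/measurable_EFinP.
have mEv : measurable_fun setT (EFin \o v) by exact/measurable_EFinP.
have mr := measurable_int _ ir.
have /integrableP[_ rlt] := ir.
have vn : \int[m]_x (EFin \o v)^\- x < +oo.
  apply: (@le_lt_trans _ _
    (\int[m]_x ((EFin \o a)^\- x + `|(r x)%:E|))); last first.
    rewrite ge0_integralD//; first exact: lte_add_pinfty.
    - exact: measurable_funeneg.
    - exact: measurableT_comp.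
  apply: ae_ge0_le_integral => //.
  - exact: measurable_funeneg.
  - by move=> x _; rewrite adde_ge0.
  - by apply: emeasurable_funD; [exact: measurable_funeneg|exact: measurableT_comp].
  - apply: filterS arv => x h _; rewrite !funenegE /=.
    rewrite -!EFin_max -EFinD lee_fin.
    have := ler_norm (- r x)%R; rewrite normrN.
    have := normr_ge0 (r x).
    by rewrite /Num.max; case: ltP => ?; case: ltP => ?; lra.
have vp : \int[m]_x (EFin \o v)^\+ x < +oo.
  move: vlt; rewrite integralE ltey => /eqP vlt.
  rewrite ltey; apply/eqP => vp; apply: vlt.
  by rewrite vp addye// eqe_oppLR/= lt_eqF.
have iv := integrable_funeposneg mEv vp vn.
have ia : m.-integrable setT (EFin \o a).
  apply: integrable_funeposneg => //.
  apply: (@le_lt_trans _ _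
    (\int[m]_x ((EFin \o v)^\+ x + `|(r x)%:E|))); last first.
    rewrite ge0_integralD//; first exact: lte_add_pinfty.
    - exact: measurable_funepos.
    - exact: measurableT_comp.
  apply: ae_ge0_le_integral => //.
  - exact: measurable_funepos.
  - by move=> x _; rewrite adde_ge0.
  - by apply: emeasurable_funD; [exact: measurable_funepos|exact: measurableT_comp].
  - apply: filterS arv => x h _; rewrite !funeposE /=.
    rewrite -!EFin_max -EFinD lee_fin.
    have := ler_norm (- r x)%R; rewrite normrN.
    have := normr_ge0 (r x).
    by rewrite /Num.max; case: ltP => ?; case: ltP => ?; lra.
split => //.
by rewrite -integralD//; apply: ae_le_integral => //; exact: integrableD.
Qed.

End integral_sandwich.

(** * Measures with a density *)

Section density.
Context d (T : measurableType d) (R : realType).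
Local Open Scope ereal_scope.

Section integral_density.
Variables (mu m : {measure set T -> \bar R}) (f : T -> R).
Hypothesis fm : is_density mu f m.

Import HBNNSimple.

Let mf : measurable_fun setT f. Proof. by case: fm. Qed.
Let f0 x : (0 <= f x)%R. Proof. by case: fm. Qed.
Let fE A : measurable A -> m A = \int[mu]_(x in A) (f x)%:E.
Proof. by case: fm => _ _; exact. Qed.

(** For an indicator this is the definition of a density; simple functions and
    monotone convergence extend it to all nonnegative functions. *)
Lemma ge0_integral_density (h : T -> \bar R) :
  measurable_fun setT h -> (forall x, 0 <= h x) ->
  \int[m]_x h x = \int[mu]_x (h x * (f x)%:E).
Proof.
move=> mh h0; pose k := nnsfun_approx measurableT mh.
have hE x : h x = limn (fun n => (k n x)%:E).
  by apply/esym/cvg_lim => //; exact: cvg_nnsfun_approx.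
have -> : \int[m]_x h x = limn (fun n => \int[m]_x (k n x)%:E).
  under eq_integral do rewrite hE.
  apply: monotone_convergence => //.
  - by move=> n; exact/measurable_EFinP.
  - by move=> n x _; rewrite lee_fin.
  - by move=> x _ a b ab; rewrite lee_fin; exact/lefP/nd_nnsfun_approx.
have -> : \int[mu]_x (h x * (f x)%:E) =
    limn (fun n => \int[mu]_x ((k n x)%:E * (f x)%:E)).
  have hfE x : h x * (f x)%:E = limn (fun n => (k n x)%:E * (f x)%:E).
    apply/esym/cvg_lim => //; apply: cvgeZr => //.
    exact: cvg_nnsfun_approx.
  under eq_integral do rewrite hfE.
  apply: monotone_convergence => //.
  - move=> n; apply: emeasurable_funM; apply/measurable_EFinP => //.
  - by move=> n x _; rewrite mule_ge0// lee_fin.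
  - move=> x _ a b ab; rewrite lee_wpmul2r ?lee_fin//.
    exact/lefP/nd_nnsfun_approx.
congr (limn _); apply/funext => n.
transitivity (\int[m]_x
   (\sum_(y \in range (k n)) (y * \1_(k n @^-1` [set y]) x)%:E)).
  by apply: eq_integral => t _; rewrite /= fimfunE -fsumEFin.
have mind r : measurable_fun setT (fun x => (r * \1_(k n @^-1` [set r]) x)%:E).
  by apply/measurable_EFinP; exact: measurable_funM.
rewrite ge0_integral_fsum//; last by move=> y x _; exact: nnfun_muleindic_ge0.
transitivity (\int[mu]_x (\sum_(y \in range (k n))
    (y * \1_(k n @^-1` [set y]) x)%:E * (f x)%:E)); last first.
  apply: eq_integral => x _.
  rewrite -ge0_mule_fsuml => [|y]; last exact: nnfun_muleindic_ge0.
  by rewrite fsumEFin // -(fimfunE _ x).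
rewrite ge0_integral_fsum//; last 2 first.
  - by move=> y; apply: emeasurable_funM => //; exact/measurable_EFinP.
  - by move=> y x _; rewrite mule_ge0 ?nnfun_muleindic_ge0 ?lee_fin.
apply: eq_fsbigr => r rkn.
rewrite integralZl_indic_nnsfun//.
under [RHS]eq_integral do rewrite EFinM -muleA.
rewrite ge0_integralZl//.
- rewrite integral_indic// setIT fE//.
  congr (_ * _); rewrite integral_mkcond; apply: eq_integral => x _.
  by rewrite epatch_indic muleC.
- by apply: emeasurable_funM; exact/measurable_EFinP.
- by move=> t _; rewrite mule_ge0 ?lee_fin.
- by move: rkn; rewrite inE => -[t _ <-]; rewrite lee_fin.
Qed.

(** As [f] is nonnegative, multiplication by [f] commutes with taking positive and
    negative parts, so both sides agree even when these have infinite integrals. *)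
Lemma integral_density (h : T -> R) : measurable_fun setT h ->
  \int[m]_x (h x)%:E = \int[mu]_x (h x * f x)%:E.
Proof.
move=> mh; rewrite integralE [RHS]integralE.
have mEh : measurable_fun setT (EFin \o h) by exact/measurable_EFinP.
congr (_ - _).
- rewrite ge0_integral_density//; last exact: measurable_funepos.
  apply: eq_integral => x _; rewrite !funeposE /= -!EFin_max -EFinM.
  by rewrite maxr_pMl// mul0r.
- rewrite ge0_integral_density//; last exact: measurable_funeneg.
  apply: eq_integral => x _; rewrite !funenegE /= -!EFin_max -EFinM.
  by rewrite maxr_pMl// mul0r mulNr.
Qed.

(** The left-hand side is the integral of [h / f] against [m]. Writing [1 / f]
    as [expR (- ln (f x))] makes it measurable by composition; where [f]
    vanishes this factor is 1, on an [m]-negligible set, and the integral of [h]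
    over that set is what is lost in the inequality. *)
Lemma integral_div_density_le (h : T -> R) :
  measurable_fun setT h -> (forall x, (0 <= h x)%R) ->
  \int[m]_x (h x * expR (- ln (f x)))%:E <= \int[mu]_x (h x)%:E.
Proof.
move=> mh h0.
have mhf : measurable_fun setT (fun x => h x * expR (- ln (f x)))%R.
  apply: measurable_funM => //; apply: measurableT_comp => //.
  by apply: measurableT_comp => //; exact: measurableT_comp.
rewrite integral_density//; apply: ge0_le_integral => //.
- by move=> x _; rewrite lee_fin !mulr_ge0// expR_ge0.
- by apply/measurable_EFinP; exact: measurable_funM.
- exact/measurable_EFinP.
- move=> x _; rewrite lee_fin.
  have := f0 x; rewrite le_eqVlt => /predU1P[<-|fx]; first by rewrite mulr0.
  by rewrite expRN lnK// divfK// gt_eqF.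
Qed.

Lemma ae_density_gt0 : {ae m, forall x, (0 < f x)%R}.
Proof.
exists (f @^-1` [set 0%R]).
have mN : measurable (f @^-1` [set 0%R]).
  by rewrite -[X in measurable X]setTI; exact: mf.
split => //.
- rewrite fE//; apply: integral0_eq => x /= ->//.
- move=> x /= /negP; rewrite -leNgt => fx0.
  by apply/eqP; rewrite eq_le fx0 f0.
Qed.

End integral_density.

Lemma exists_density_probability (mu : {measure set T -> \bar R}) (f : T -> R) :
  measurable_fun setT f -> (forall x, (0 <= f x)%R) ->
  \int[mu]_x (f x)%:E = 1 ->
  exists m : probability T R, is_density mu f m.
Proof.
move=> mf f0 f1.
pose m A := \int[mu]_(x in A) (f x)%:E.
have m0 : m set0 = 0 by rewrite /m integral_set0.
have mge0 A : 0 <= m A by apply: integral_ge0 => x _; rewrite lee_fin.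
have msigma : semi_sigma_additive m.
  move=> F mF tF mUF; rewrite /m ge0_integral_bigcup//; last 2 first.
  - by apply: measurable_funTS; exact/measurable_EFinP.
  - by move=> x _; rewrite lee_fin.
  apply: is_cvg_ereal_nneg_natsum_cond => n _ _.
  by apply: integral_ge0 => x _; rewrite lee_fin.
pose i1 := isMeasure.Build _ _ _ m m0 mge0 msigma.
pose mm : {measure set T -> \bar R} := HB.pack m i1.
pose i2 := @Measure_isProbability.Build _ _ R mm f1.
pose pm : probability T R := HB.pack m i1 i2.
by exists pm; split.
Qed.

End density.

(** * Product integrals and Gaussian densities *)

Section lebesgue_tuple_integral.
Context (R : realType).
Local Open Scope ereal_scope.

Lemma integral_lebesgue_tupleS n (f : Rn R n.+1 -> \bar R) :
  measurable_fun setT f -> (forall x, 0 <= f x) ->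
  \int[lebesgue_tuple R n.+1]_x f x =
  \int[@lebesgue_measure R]_a \int[lebesgue_tuple R n]_t f (tcons (a, t)).
Proof.
move=> mf f0; transitivity
  (\int[pushforward (@lebesgue_measure R \x lebesgue_tuple R n) (@tcons R n)]_x f x).
  by [].
rewrite ge0_integral_pushforward//; last exact: measurable_tcons.
rewrite preimage_setT fubini_tonelli1//=.
by apply: measurableT_comp => //; exact: measurable_tcons.
Qed.

Lemma integral_lebesgue_tuple_prod n (h : 'I_n -> R -> R) :
  (forall i, measurable_fun setT (h i)) -> (forall i x, (0 <= h i x)%R) ->
  \int[lebesgue_tuple R n]_t (\prod_(i < n) h i (tnth t i))%:E =
  \prod_(i < n) \int[@lebesgue_measure R]_a (h i a)%:E.
Proof.
elim: n h => [|n IH] h mh h0.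
  rewrite big_ord0 /= integral_dirac//=.
    by rewrite diracT mul1e big_ord0.
  rewrite (_ : (fun _ => _) = cst 1)//.
  by apply/funext => t; rewrite big_ord0.
have mprod k (g : 'I_k -> R -> R) : (forall i, measurable_fun setT (g i)) ->
    measurable_fun setT (fun t : Rn R k => (\prod_(i < k) g i (tnth t i))%R).
  move=> mg; apply: measurable_prod => i _.
  exact: (measurableT_comp (mg i) (measurable_tnth i)).
rewrite integral_lebesgue_tupleS; last 2 first.
- by apply/measurable_EFinP; exact: mprod.
- by move=> x; rewrite lee_fin; apply: prodr_ge0.
rewrite big_ord_recl.
transitivity (\int[@lebesgue_measure R]_a ((h ord0 a)%:E *
    \prod_(i < n) \int[@lebesgue_measure R]_b (h (lift ord0 i) b)%:E)).
  apply: eq_integral => a _; rewrite -IH//.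
  rewrite -ge0_integralZl//; last 3 first.
  - apply/measurable_EFinP.
    by apply: (mprod _ (fun i => h (lift ord0 i))) => i; exact: mh.
  - by move=> t _; rewrite lee_fin; apply: prodr_ge0.
  - by rewrite lee_fin.
  apply: eq_integral => t _.
  rewrite big_ord_recl -EFinM; congr (_ * _)%:E; apply: eq_bigr => i _.
  by rewrite /tcons/= tnthS.
rewrite ge0_integralZr//.
- by apply/measurable_EFinP; exact: mh.
- by move=> a _; rewrite lee_fin.
- by apply: prode_ge0 => i _; apply: integral_ge0 => b _; rewrite lee_fin.
Qed.

End lebesgue_tuple_integral.

Section gaussian.
Context (R : realType) (n : nat).
Implicit Types (v : R) (x y z : Rn R n).

Lemma sqnorm_ge0 x : 0 <= sqnorm x.
Proof. by apply: sumr_ge0 => i _; exact: sqr_ge0. Qed.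

Lemma sqnorm_tsubC x y : sqnorm (tsub x y) = sqnorm (tsub y x).
Proof.
by apply: eq_bigr => i _; rewrite !tnth_mktuple -sqrrN opprB.
Qed.

Lemma sqnorm_tsub_le x y : sqnorm (tsub x y) <= 2 * sqnorm x + 2 * sqnorm y.
Proof.
rewrite /sqnorm !mulr_sumr -big_split/=; apply: ler_sum => i _.
by rewrite tnth_mktuple; have := sqr_ge0 (tnth x i + tnth y i); nra.
Qed.

Lemma sqnorm_le_tsub x y : sqnorm y <= 2 * sqnorm x + 2 * sqnorm (tsub y x).
Proof.
rewrite /sqnorm !mulr_sumr -big_split/=; apply: ler_sum => i _.
by rewrite tnth_mktuple; have := sqr_ge0 (2 * tnth x i - tnth y i); nra.
Qed.

Lemma measurable_sqnorm : measurable_fun setT (@sqnorm R n).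
Proof.
apply: measurable_sum => i; apply: measurable_funX.
exact: measurable_tnth.
Qed.

Lemma measurable_sqnorm_tsub :
  measurable_fun setT (fun z : Rn R n * Rn R n => sqnorm (tsub z.1 z.2)).
Proof.
rewrite /sqnorm; under eq_fun do under eq_bigr do rewrite tnth_mktuple.
apply: measurable_sum => i; apply: measurable_funX; apply: measurable_funB.
- exact: (measurableT_comp (measurable_tnth i) measurable_fst).
- exact: (measurableT_comp (measurable_tnth i) measurable_snd).
Qed.

Definition gauss_norm v : R := Num.sqrt (2 * pi * v) ^+ n.

Lemma gauss_norm_gt0 v : 0 < v -> 0 < gauss_norm v.
Proof.
by move=> v0; rewrite exprn_gt0// sqrtr_gt0 !mulr_gt0// pi_gt0.
Qed.

Lemma gauss_pdf_gt0 v z : 0 < v -> 0 < gauss_pdf v z.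
Proof.
by move=> v0; rewrite mulr_gt0 ?expR_gt0// invr_gt0 gauss_norm_gt0.
Qed.

Lemma ln_gauss_pdf v z : 0 < v ->
  ln (gauss_pdf v z) = - ln (gauss_norm v) - sqnorm z / (2 * v).
Proof.
move=> v0; have c0 := gauss_norm_gt0 v0.
by rewrite lnM ?posrE ?invr_gt0 ?expR_gt0// lnV ?posrE// expRK.
Qed.

Lemma gauss_pdf_le v z : 0 < v -> gauss_pdf v z <= (gauss_norm v)^-1.
Proof.
move=> v0; apply: ler_piMr; first by rewrite invr_ge0 ltW// gauss_norm_gt0.
by rewrite -[leRHS]expR0 ler_expR oppr_le0 divr_ge0 ?sqnorm_ge0// mulr_ge0// ltW.
Qed.

(** Half of the exponent absorbs the factor [|z|^2], at the cost of doubling the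
    variance. This bounds the second moment without computing it. *)
Lemma gauss_pdf_sqnorm_le v z : 0 < v ->
  sqnorm z * gauss_pdf v z <=
  4 * v * (gauss_norm (2 * v) / gauss_norm v) * gauss_pdf (2 * v) z.
Proof.
move=> v0; have v20 : 0 < 2 * v by rewrite mulr_gt0.
have c0 := gauss_norm_gt0 v0; have c20 := gauss_norm_gt0 v20.
rewrite /gauss_pdf -/(gauss_norm v) -/(gauss_norm (2 * v)).
set s := sqnorm z; pose w := s / (4 * v).
have -> : s / (2 * v) = w + w by rewrite /w; field; rewrite gt_eqF.
have -> : s / (2 * (2 * v)) = w by rewrite /w; field; rewrite gt_eqF.
have -> : s = 4 * v * w by rewrite /w; field; rewrite gt_eqF.
rewrite opprD expRD.
have -> : 4 * v * (gauss_norm (2 * v) / gauss_norm v) *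
   ((gauss_norm (2 * v))^-1 * expR (- w)) =
   (4 * v * (gauss_norm v)^-1 * expR (- w)) * 1.
  by field; rewrite !gt_eqF.
have -> : 4 * v * w * ((gauss_norm v)^-1 * (expR (- w) * expR (- w))) =
  (4 * v * (gauss_norm v)^-1 * expR (- w)) * (w * expR (- w)).
  by ring.
apply: ler_wpM2l.
  by rewrite mulr_ge0 ?expR_ge0// divr_ge0 ?mulr_ge0 ?(ltW c0) ?(ltW v0).
rewrite expRN ler_pdivrMr ?expR_gt0// mul1r.
by have := expR_ge1Dx w; lra.
Qed.

Lemma measurable_gauss_pdf v : measurable_fun setT (@gauss_pdf R n v).
Proof.
apply: measurable_funM => //; apply: measurableT_comp => //.
apply: measurableT_comp => //; apply: measurable_funM => //.
exact: measurable_sqnorm.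
Qed.

Lemma measurable_gauss_pdf_tsub v :
  measurable_fun setT (fun z : Rn R n * Rn R n => gauss_pdf v (tsub z.2 z.1)).
Proof.
apply: measurable_funM => //; apply: measurableT_comp => //.
apply: measurableT_comp => //; apply: measurable_funM => //.
under eq_fun do rewrite sqnorm_tsubC.
exact: measurable_sqnorm_tsub.
Qed.

Lemma integral_gauss_pdf_tsub v x : 0 < v ->
  (\int[lebesgue_tuple R n]_y (gauss_pdf v (tsub y x))%:E = 1)%E.
Proof.
move=> v0; have s0 : Num.sqrt v != 0 by rewrite sqrtr_eq0 -ltNge.
transitivity (\int[lebesgue_tuple R n]_y
   (\prod_(i < n) normal_pdf (tnth x i) (Num.sqrt v) (tnth y i))%:E)%E.
  apply: eq_integral => y _; rewrite gauss_pdf_prod//; congr EFin.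
  apply: eq_bigr => i _; rewrite tnth_mktuple !normal_pdfE//.
  by rewrite /normal_fun subr0.
rewrite (@integral_lebesgue_tuple_prod _ _ (fun i => normal_pdf (tnth x i) (Num.sqrt v))).
- by rewrite big1// => i _; exact: integral_normal_pdf.
- by move=> i; exact: measurable_normal_pdf.
- by move=> i a; exact: normal_pdf_ge0.
Qed.

Lemma integral_gauss_pdf v : 0 < v ->
  (\int[lebesgue_tuple R n]_y (gauss_pdf v y)%:E = 1)%E.
Proof.
move=> v0; rewrite -[RHS](integral_gauss_pdf_tsub [tuple 0 | i < n] v0).
apply: eq_integral => y _; congr ((gauss_pdf _ _)%:E).
by apply: eq_from_tnth => i; rewrite !tnth_mktuple subr0.
Qed.

Lemma integral_sqnorm_gauss_pdf_le v x : 0 < v ->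
  (\int[lebesgue_tuple R n]_y (sqnorm (tsub y x) * gauss_pdf v (tsub y x))%:E <=
   (4 * v * (gauss_norm (2 * v) / gauss_norm v))%:E)%E.
Proof.
move=> v0; have v20 : 0 < 2 * v by rewrite mulr_gt0.
have mpair : measurable_fun setT (fun y : Rn R n => (x, y)) by exact: measurable_fun_pair.
have mg u : measurable_fun setT (fun y => gauss_pdf u (tsub y x)).
  exact: (measurableT_comp (measurable_gauss_pdf_tsub u) mpair).
have ms : measurable_fun setT (fun y => sqnorm (tsub y x)).
  under eq_fun do rewrite sqnorm_tsubC.
  exact: (measurableT_comp measurable_sqnorm_tsub mpair).
have C0 : 0 <= 4 * v * (gauss_norm (2 * v) / gauss_norm v).
  by rewrite !mulr_ge0 ?invr_ge0 ?ltW ?gauss_norm_gt0.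
rewrite -[leRHS]mule1 -(integral_gauss_pdf_tsub x v20) -ge0_integralZl//.
- apply: ge0_le_integral => //.
  + by move=> y _; rewrite lee_fin mulr_ge0 ?sqnorm_ge0// ltW// gauss_pdf_gt0.
  + by apply/measurable_EFinP; exact: measurable_funM.
  + by apply: emeasurable_funM => //; exact/measurable_EFinP.
  + by move=> y _; rewrite lee_fin gauss_pdf_sqnorm_le.
- exact/measurable_EFinP.
- by move=> y _; rewrite lee_fin ltW// gauss_pdf_gt0.
Qed.

End gaussian.

(** * Couplings and the Gaussian coupling *)

Section density_existence.
Context d (T : measurableType d) (R : realType).

Lemma exists_density (mu : {sigma_finite_measure set T -> \bar R})
    (P : probability T R) : P `<< mu -> exists p, is_density mu p P.
Proof.
move=> Pmu; have [f [f0 ffin fi fE]] := radon_nikodym_sigma_finite Pmu.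
have fineKf x : (fine (f x))%:E = f x by rewrite fineK.
exists (fine \o f); split.
- by apply: measurableT_comp => //; exact: measurable_int fi.
- by move=> x; exact: fine_ge0.
- by move=> A mA; rewrite fE//; apply: eq_integral => x _ /=; rewrite fineKf.
Qed.

Lemma density_dominates (mu m : {measure set T -> \bar R}) (f : T -> R) :
  is_density mu f m -> m `<< mu.
Proof.
move=> [mf f0 mE]; apply/null_content_dominatesP => A mA muA0.
rewrite mE//; apply: null_set_integral => //.
by apply/measurable_EFinP; exact: measurable_funTS.
Qed.

End density_existence.

Section marginals.
Context (R : realType) (n : nat).
Local Open Scope ereal_scope.
Variables (P Q : probability (Rn R n) R).
Variable pi : probability (Rn R n * Rn R n)%type R.
Hypothesis cpl : is_coupling P Q pi.

Lemma integral_coupling_fst (h : Rn R n -> \bar R) :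
  measurable_fun setT h -> (forall x, 0 <= h x) ->
  \int[pi]_z h z.1 = \int[P]_x h x.
Proof.
move=> mh h0.
transitivity (\int[pushforward pi fst]_x h x).
  by rewrite ge0_integral_pushforward.
pose m := measure_function_pushforward__canonical__measure_function_Measure
  pi (@measurable_fst _ _ (Rn R n) (Rn R n)).
by apply: (@eq_measure_integral _ _ _ setT _ m) => A mA _; exact: (cpl mA).1.
Qed.

Lemma integral_coupling_snd (h : Rn R n -> \bar R) :
  measurable_fun setT h -> (forall x, 0 <= h x) ->
  \int[pi]_z h z.2 = \int[Q]_x h x.
Proof.
move=> mh h0.
transitivity (\int[pushforward pi snd]_x h x).
  by rewrite ge0_integral_pushforward.
pose m := measure_function_pushforward__canonical__measure_function_Measure
  pi (@measurable_snd _ _ (Rn R n) (Rn R n)).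
by apply: (@eq_measure_integral _ _ _ setT _ m) => A mA _; exact: (cpl mA).2.
Qed.

End marginals.

Section gaussian_coupling.
Context (R : realType) (n : nat).
Variables (P : probability (Rn R n) R) (p : Rn R n -> R) (v : R).
Hypotheses (v0 : 0 < v) (pP : is_density (lebesgue_tuple R n) p P).
Local Notation mu := (lebesgue_tuple R n).

(** The joint density of [X] and [X + Z], where [X] has density [p] and [Z] is an
    independent centred Gaussian vector of covariance [v I]. *)
Definition gauss_joint_pdf (z : Rn R n * Rn R n) : R :=
  p z.1 * gauss_pdf v (tsub z.2 z.1).

Let mp : measurable_fun setT p. Proof. by case: pP. Qed.
Let p0 x : 0 <= p x. Proof. by case: pP. Qed.
Let mp1 : measurable_fun setT (fun z : Rn R n * Rn R n => p z.1).
Proof. exact: (measurableT_comp mp measurable_fst). Qed.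

Lemma gauss_joint_pdf_ge0 z : 0 <= gauss_joint_pdf z.
Proof. by rewrite mulr_ge0// ltW// gauss_pdf_gt0. Qed.

Lemma measurable_gauss_joint_pdf : measurable_fun setT gauss_joint_pdf.
Proof. by apply: measurable_funM => //; exact: measurable_gauss_pdf_tsub. Qed.

Local Open Scope ereal_scope.

Lemma integral_density_fst (k : Rn R n * Rn R n -> R) :
  measurable_fun setT k -> (forall z, (0 <= k z)%R) ->
  \int[lebesgue_tuple2 R n]_z (p z.1 * k z)%:E =
  \int[P]_x \int[mu]_y (k (x, y))%:E.
Proof.
move=> mk k0; rewrite /lebesgue_tuple2.
have mEk : measurable_fun setT (EFin \o k) by exact/measurable_EFinP.
rewrite (fubini_tonelli1 (fun z => (p z.1 * k z)%:E)); last 2 first.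
- by apply/measurable_EFinP; exact: measurable_funM.
- by move=> z; rewrite lee_fin mulr_ge0.
rewrite (ge0_integral_density pP); last 2 first.
- exact: (measurable_fun_fubini_tonelli_F (EFin \o k)).
- by move=> x; apply: integral_ge0 => y _; rewrite lee_fin.
apply: eq_integral => x _; rewrite muleC /fubini_F -ge0_integralZl//.
- exact: (measurableT_comp mEk (measurable_pair1 x)).
- by move=> y _; rewrite lee_fin.
- by rewrite lee_fin.
Qed.

Lemma integrable_density_gauss_pdf y :
  mu.-integrable setT (fun x => (p x * gauss_pdf v (tsub y x))%:E).
Proof.
have mg : measurable_fun setT (fun x => gauss_pdf v (tsub y x)).
  exact: (measurableT_comp (measurable_gauss_pdf_tsub v) (measurable_pair2 y)).
apply/integrableP; split; first by apply/measurable_EFinP; exact: measurable_funM.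
apply: (@le_lt_trans _ _ (\int[mu]_x ((gauss_norm n v)^-1%:E * (p x)%:E))).
  apply: ge0_le_integral => //.
  - by apply: measurableT_comp => //; apply/measurable_EFinP; exact: measurable_funM.
  - by apply: emeasurable_funM => //; exact/measurable_EFinP.
  - move=> x _; rewrite gee0_abs; last first.
      by rewrite lee_fin mulr_ge0// ltW// gauss_pdf_gt0.
    by rewrite -EFinM lee_fin mulrC ler_wpM2r// gauss_pdf_le.
rewrite ge0_integralZl//.
- have [_ _ <-//] := pP.
  by rewrite probability_setT mule1 ltry.
- exact/measurable_EFinP.
- by move=> x _; rewrite lee_fin.
- by rewrite lee_fin invr_ge0 ltW// gauss_norm_gt0.
Qed.

(** [convolution] is a real-valued integral; it carries the measure-theoretic
    meaning because the Gaussian density is bounded. *)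
Lemma EFin_convolution y : (convolution p (gauss_pdf v) y)%:E =
  \int[mu]_x (gauss_joint_pdf (x, y))%:E.
Proof.
rewrite /convolution fineK//.
exact: integrable_fin_num (integrable_density_gauss_pdf y).
Qed.

Lemma measurable_convolution : measurable_fun setT (convolution p (gauss_pdf v)).
Proof.
apply/measurable_EFinP.
rewrite (_ : _ \o _ = fubini_G mu (EFin \o gauss_joint_pdf)); last first.
  by apply/funext => y; exact: EFin_convolution.
apply: measurable_fun_fubini_tonelli_G.
- by apply/measurable_EFinP; exact: measurable_gauss_joint_pdf.
- by move=> z; rewrite lee_fin gauss_joint_pdf_ge0.
Qed.

Lemma convolution_ge0 y : (0 <= convolution p (gauss_pdf v) y)%R.
Proof.
rewrite -lee_fin EFin_convolution; apply: integral_ge0 => x _.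
by rewrite lee_fin gauss_joint_pdf_ge0.
Qed.

Lemma integral_gauss_joint_fst (h : Rn R n -> R) :
  measurable_fun setT h -> (forall x, (0 <= h x)%R) ->
  \int[lebesgue_tuple2 R n]_z (h z.1 * gauss_joint_pdf z)%:E =
  \int[P]_x (h x)%:E.
Proof.
move=> mh h0.
have mh1 : measurable_fun setT (fun z : Rn R n * Rn R n => h z.1).
  exact: (measurableT_comp mh measurable_fst).
under eq_integral do rewrite /gauss_joint_pdf mulrCA.
rewrite (@integral_density_fst (fun z => h z.1 * gauss_pdf v (tsub z.2 z.1))%R).
- apply: eq_integral => x _ /=; under eq_integral do rewrite EFinM.
  rewrite ge0_integralZl//.
  + by rewrite integral_gauss_pdf_tsub// mule1.
  + apply/measurable_EFinP.
    exact: (measurableT_comp (measurable_gauss_pdf_tsub v) (measurable_pair1 x)).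
  + by move=> y _; rewrite lee_fin ltW// gauss_pdf_gt0.
  + by rewrite lee_fin.
- by apply: measurable_funM => //; exact: measurable_gauss_pdf_tsub.
- by move=> z; rewrite mulr_ge0// ltW// gauss_pdf_gt0.
Qed.

Lemma integral_gauss_joint_snd (h : Rn R n -> R) :
  measurable_fun setT h -> (forall x, (0 <= h x)%R) ->
  \int[lebesgue_tuple2 R n]_z (h z.2 * gauss_joint_pdf z)%:E =
  \int[mu]_y (h y * convolution p (gauss_pdf v) y)%:E.
Proof.
move=> mh h0; rewrite /lebesgue_tuple2.
have mh2 : measurable_fun setT (fun z : Rn R n * Rn R n => h z.2).
  exact: (measurableT_comp mh measurable_snd).
have mEg : measurable_fun setT (EFin \o gauss_joint_pdf).
  by apply/measurable_EFinP; exact: measurable_gauss_joint_pdf.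
rewrite (fubini_tonelli2 (fun z => (h z.2 * gauss_joint_pdf z)%:E)); last 2 first.
- apply/measurable_EFinP; apply: measurable_funM => //.
  exact: measurable_gauss_joint_pdf.
- by move=> z; rewrite lee_fin mulr_ge0// gauss_joint_pdf_ge0.
apply: eq_integral => y _; rewrite EFinM EFin_convolution /fubini_G -ge0_integralZl//.
- exact: (measurableT_comp mEg (measurable_pair2 y)).
- by move=> x _; rewrite lee_fin gauss_joint_pdf_ge0.
- by rewrite lee_fin.
Qed.

Lemma exists_gauss_coupling :
  exists (Q : probability (Rn R n) R)
    (pi : probability (Rn R n * Rn R n)%type R),
  [/\ is_density mu (convolution p (gauss_pdf v)) Q,
      is_density (lebesgue_tuple2 R n) gauss_joint_pdf pi &
      is_coupling P Q pi].
Proof.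
have int1 : \int[lebesgue_tuple2 R n]_z (gauss_joint_pdf z)%:E = 1.
  transitivity (\int[lebesgue_tuple2 R n]_z (cst 1%R z.1 * gauss_joint_pdf z)%:E).
    by apply: eq_integral => z _; rewrite mul1r.
  rewrite integral_gauss_joint_fst//.
  rewrite -[LHS]/(\int[P]_x cst 1 x) integral_cst// mul1e.
  exact: probability_setT.
have [pi pig] := exists_density_probability measurable_gauss_joint_pdf
  gauss_joint_pdf_ge0 int1.
have [|Q Qq] := exists_density_probability (mu := mu) measurable_convolution
  convolution_ge0.
  transitivity (\int[mu]_y (cst 1%R y * convolution p (gauss_pdf v) y)%:E).
    by apply: eq_integral => z _; rewrite mul1r.
  rewrite -integral_gauss_joint_snd// -[RHS]int1.
  by apply: eq_integral => z _; rewrite mul1r.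
have mindic A : measurable A -> measurable_fun setT (\1_A : Rn R n -> R).
  by move=> mA; exact: measurable_indic.
exists Q, pi; split => // A mA; split.
- have -> : pushforward pi fst A = \int[pi]_z (\1_A z.1)%:E.
    rewrite -[RHS]/(\int[pi]_z (\1_(fst @^-1` A) z)%:E) integral_indic//.
      by rewrite setIT.
    by rewrite -[X in measurable X]setTI; exact: measurable_fst.
  rewrite (integral_density pig); last first.
    exact: (measurableT_comp (mindic A mA) measurable_fst).
  by rewrite integral_gauss_joint_fst// integral_indic// setIT.
- have -> : pushforward pi snd A = \int[pi]_z (\1_A z.2)%:E.
    rewrite -[RHS]/(\int[pi]_z (\1_(snd @^-1` A) z)%:E) integral_indic//.
      by rewrite setIT.
    by rewrite -[X in measurable X]setTI; exact: measurable_snd.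
  rewrite (integral_density pig); last first.
    exact: (measurableT_comp (mindic A mA) measurable_snd).
  by rewrite integral_gauss_joint_snd// -(integral_density Qq)// integral_indic// setIT.
Qed.

(** Since [|y|^2 <= 2 |x|^2 + 2 |y - x|^2], the second moment of [X + Z] is bounded
    by those of [X] and [Z]. *)
Lemma gauss_coupling_P2 (Q : probability (Rn R n) R) :
  is_density mu (convolution p (gauss_pdf v)) Q ->
  \int[P]_x (sqnorm x)%:E < +oo -> P2 Q.
Proof.
move=> Qq P2P; split; first exact: density_dominates Qq.
have msq := @measurable_sqnorm R n.
have mstsub : measurable_fun setT
    (fun z : Rn R n * Rn R n => sqnorm (tsub z.2 z.1)).
  under eq_fun do rewrite sqnorm_tsubC.
  exact: measurable_sqnorm_tsub.
have msq1 : measurable_fun setT (fun z : Rn R n * Rn R n => sqnorm z.1).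
  exact: (measurableT_comp msq measurable_fst).
have msq2 : measurable_fun setT (fun z : Rn R n * Rn R n => sqnorm z.2).
  exact: (measurableT_comp msq measurable_snd).
have mg := measurable_gauss_joint_pdf.
rewrite (integral_density Qq)// -integral_gauss_joint_snd//; last exact: sqnorm_ge0.
apply: (@le_lt_trans _ _ (\int[lebesgue_tuple2 R n]_z
  (2%:E * (sqnorm z.1 * gauss_joint_pdf z)%:E +
   2%:E * (sqnorm (tsub z.2 z.1) * gauss_joint_pdf z)%:E))).
  apply: ge0_le_integral => //.
  - by move=> z _; rewrite lee_fin mulr_ge0 ?sqnorm_ge0 ?gauss_joint_pdf_ge0.
  - by apply/measurable_EFinP; exact: measurable_funM.
  - apply: emeasurable_funD; apply: emeasurable_funM => //;
    by apply/measurable_EFinP; exact: measurable_funM.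
  - move=> z _; rewrite -!EFinM -EFinD lee_fin.
    have := ler_wpM2r (gauss_joint_pdf_ge0 z) (sqnorm_le_tsub z.1 z.2).
    by rewrite mulrDl -!mulrA.
rewrite ge0_integralD//; last 4 first.
- by move=> z _; rewrite -EFinM lee_fin !mulr_ge0 ?sqnorm_ge0 ?gauss_joint_pdf_ge0.
- by apply: emeasurable_funM => //; apply/measurable_EFinP; exact: measurable_funM.
- by move=> z _; rewrite -EFinM lee_fin !mulr_ge0 ?sqnorm_ge0 ?gauss_joint_pdf_ge0.
- by apply: emeasurable_funM => //; apply/measurable_EFinP; exact: measurable_funM.
have Dlt : \int[lebesgue_tuple2 R n]_z
    (sqnorm (tsub z.2 z.1) * gauss_joint_pdf z)%:E < +oo.
  under eq_integral do rewrite /gauss_joint_pdf mulrCA.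
  rewrite (@integral_density_fst
    (fun z => sqnorm (tsub z.2 z.1) * gauss_pdf v (tsub z.2 z.1))%R).
  - apply: (@le_lt_trans _ _ (\int[P]_x
        (4 * v * (gauss_norm n (2 * v) / gauss_norm n v))%:E)).
      apply: ge0_le_integral => //.
      + move=> x _; apply: integral_ge0 => y _.
        by rewrite lee_fin mulr_ge0 ?sqnorm_ge0// ltW// gauss_pdf_gt0.
      + apply: (measurable_fun_fubini_tonelli_F (fun z =>
          (sqnorm (tsub z.2 z.1) * gauss_pdf v (tsub z.2 z.1))%:E)).
        * apply/measurable_EFinP; apply: measurable_funM => //.
          exact: measurable_gauss_pdf_tsub.
        * by move=> z; rewrite lee_fin mulr_ge0 ?sqnorm_ge0// ltW// gauss_pdf_gt0.
      + by move=> x _; exact: integral_sqnorm_gauss_pdf_le.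
    rewrite integral_cst//; apply: lte_mul_pinfty => //.
      by rewrite lee_fin mulr_ge0 ?divr_ge0 ?mulr_ge0// ltW// gauss_norm_gt0// mulr_gt0.
    by apply: le_lt_trans (ltry 1); exact: probability_le1.
  - by apply: measurable_funM => //; exact: measurable_gauss_pdf_tsub.
  - by move=> z; rewrite mulr_ge0 ?sqnorm_ge0// ltW// gauss_pdf_gt0.
rewrite !ge0_integralZl//; last 4 first.
- by apply/measurable_EFinP; exact: measurable_funM.
- by move=> z _; rewrite lee_fin !mulr_ge0 ?sqnorm_ge0 ?gauss_joint_pdf_ge0.
- by apply/measurable_EFinP; exact: measurable_funM.
- by move=> z _; rewrite lee_fin !mulr_ge0 ?sqnorm_ge0 ?gauss_joint_pdf_ge0.
rewrite integral_gauss_joint_fst//; last exact: sqnorm_ge0.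
by rewrite lte_add_pinfty// lte_mul_pinfty.
Qed.

End gaussian_coupling.

(** * Means under couplings *)

Section mean.
Context d (T : measurableType d) (R : realType) (m : probability T R).
Implicit Types f g : T -> R.

(** Pairing integrability with the value of the integral lets linear combinations
    be integrated without separate side conditions. *)
Definition has_mean f (a : R) : Prop :=
  m.-integrable setT (EFin \o f) /\ (\int[m]_x (f x)%:E = a%:E)%E.

Lemma has_mean_cst (c : R) : has_mean (fun=> c) c.
Proof.
split; first exact: finite_measure_integrable_cst.
rewrite -[LHS]/(\int[m]_x cst c%:E x)%E integral_cst//.
by rewrite [X in (_ * X)%E]probability_setT mule1.
Qed.

Lemma has_meanD f g a b : has_mean f a -> has_mean g b ->
  has_mean (fun x => f x + g x) (a + b).
Proof.
move=> [fi fa] [gi gb]; split; first exact: (integrableD measurableT fi gi).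
by under eq_integral do rewrite EFinD; rewrite integralD// fa gb.
Qed.

Lemma has_meanZ f a (c : R) : has_mean f a ->
  has_mean (fun x => c * f x) (c * a).
Proof.
move=> [fi fa]; split; first exact: (integrableZl measurableT c fi).
by under eq_integral do rewrite EFinM; rewrite integralZl// fa.
Qed.

Lemma integrable_has_mean f : m.-integrable setT (EFin \o f) ->
  exists a, has_mean f a.
Proof.
move=> fi; exists (fine (\int[m]_x (f x)%:E)%E); split => //.
by rewrite fineK//; exact: integrable_fin_num fi.
Qed.

Lemma ge0_has_mean f : measurable_fun setT f -> (forall x, 0 <= f x) ->
  (\int[m]_x (f x)%:E < +oo)%E -> exists a, has_mean f a.
Proof.
move=> mf f0 flt; apply: integrable_has_mean; apply/integrableP; split.
  exact/measurable_EFinP.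
by under eq_integral do rewrite gee0_abs ?lee_fin//.
Qed.

Lemma has_mean_indic (A : set T) : measurable A ->
  has_mean \1_A (fine (m A)).
Proof.
move=> mA; split; first exact: integrable_indic.
by rewrite integral_indic// setIT fineK// fin_num_measure.
Qed.

End mean.

Section coupling_mean.
Context (R : realType) (n : nat).
Variables (P Q : probability (Rn R n) R).
Variable pi : probability (Rn R n * Rn R n)%type R.
Hypothesis cpl : is_coupling P Q pi.

Lemma has_mean_coupling_fst (h : Rn R n -> R) (a : R) :
  measurable_fun setT h -> has_mean pi (fun z => h z.1) a <-> has_mean P h a.
Proof.
move=> mh; have mEh : measurable_fun setT (EFin \o h) by exact/measurable_EFinP.
have intE : (\int[pi]_z (h z.1)%:E = \int[P]_x (h x)%:E)%E.
  rewrite integralE [RHS]integralE; congr (_ - _)%E.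
  - rewrite -(integral_coupling_fst cpl (measurable_funepos mEh))//.
    by apply: eq_integral => z _; rewrite !funeposE.
  - rewrite -(integral_coupling_fst cpl (measurable_funeneg mEh))//.
    by apply: eq_integral => z _; rewrite !funenegE.
have absE : (\int[pi]_z `|(h z.1)%:E| = \int[P]_x `|(h x)%:E|)%E.
  have mabs : measurable_fun setT (abse \o (EFin \o h)) by exact: measurableT_comp.
  by rewrite -(integral_coupling_fst cpl mabs)// => x; exact: abse_ge0.
split=> -[/integrableP[mf flt] hE]; split.
- by apply/integrableP; split => //; rewrite -absE.
- exact: etrans (esym intE) hE.
- apply/integrableP; split; first exact: (measurableT_comp mEh measurable_fst).
  by apply: le_lt_trans flt; rewrite -absE.
- exact: etrans intE hE.
Qed.

Lemma has_mean_coupling_snd_indic (A : set (Rn R n)) : measurable A ->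
  has_mean pi (fun z => \1_A z.2) (fine (Q A)).
Proof.
move=> mA; have mI : measurable (snd @^-1` A : set (Rn R n * Rn R n)).
  by rewrite -[X in measurable X]setTI; exact: measurable_snd.
have <- : pi (snd @^-1` A) = Q A by exact: (cpl mA).2.
rewrite (_ : (fun z => _) = \1_(snd @^-1` A)); last by apply/funext.
exact: (has_mean_indic pi mI).
Qed.

Lemma has_mean_transport :
  (\int[P]_x (sqnorm x)%:E < +oo)%E -> (\int[Q]_x (sqnorm x)%:E < +oo)%E ->
  exists a, has_mean pi (fun z => sqnorm (tsub z.1 z.2)) a.
Proof.
move=> Plt Qlt; have mD := @measurable_sqnorm_tsub R n.
apply: ge0_has_mean => //; first by move=> z; exact: sqnorm_ge0.
have msq := @measurable_sqnorm R n.
have mE : measurable_fun setT (fun x : Rn R n => (sqnorm x)%:E).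
  exact/measurable_EFinP.
have mE1 : measurable_fun setT (fun z : Rn R n * Rn R n => (sqnorm z.1)%:E).
  exact: (measurableT_comp mE measurable_fst).
have mE2 : measurable_fun setT (fun z : Rn R n * Rn R n => (sqnorm z.2)%:E).
  exact: (measurableT_comp mE measurable_snd).
apply: (@le_lt_trans _ _
  (\int[pi]_z (2%:E * (sqnorm z.1)%:E + 2%:E * (sqnorm z.2)%:E))%E).
  apply: ge0_le_integral => //.
  - by move=> z _; rewrite lee_fin sqnorm_ge0.
  - exact/measurable_EFinP.
  - by apply: emeasurable_funD; apply: emeasurable_funM.
  - by move=> z _; rewrite -!EFinM -EFinD lee_fin sqnorm_tsub_le.
rewrite ge0_integralD//; last 4 first.
- by move=> z _; rewrite mule_ge0// lee_fin sqnorm_ge0.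
- exact: emeasurable_funM.
- by move=> z _; rewrite mule_ge0// lee_fin sqnorm_ge0.
- exact: emeasurable_funM.
rewrite !ge0_integralZl//; last 2 first.
- by move=> z _; rewrite lee_fin sqnorm_ge0.
- by move=> z _; rewrite lee_fin sqnorm_ge0.
rewrite (integral_coupling_fst cpl mE); last by move=> x; rewrite lee_fin sqnorm_ge0.
rewrite (integral_coupling_snd cpl mE); last by move=> x; rewrite lee_fin sqnorm_ge0.
by rewrite lte_add_pinfty// lte_mul_pinfty.
Qed.

(** Used with [U x] meaning [0 < p x], which fails only on a [P]-null set. *)
Lemma ae_coupling_fst (U : Rn R n -> Prop) :
  {ae P, forall x, U x} -> {ae pi, forall z, U z.1}.
Proof.
move=> [N [mN PN0 UN]]; exists (fst @^-1` N); split.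
- by rewrite -[X in measurable X]setTI; exact: measurable_fst.
- by rewrite -PN0 -(cpl mN).1.
- by move=> z; exact: UN.
Qed.

End coupling_mean.

(** * The transport objective and its lower bound *)

Section eot.
Context (R : realType) (n : nat) (lam : R) (lam0 : 0 < lam).
Variables (P : probability (Rn R n) R) (p : Rn R n -> R).
Hypotheses (P2P : (\int[P]_x (sqnorm x)%:E < +oo)%E).
Hypothesis (pP : is_density (lebesgue_tuple R n) p P).
Local Notation mu := (lebesgue_tuple R n).
Local Notation mu2 := (lebesgue_tuple2 R n).
Local Notation C := (ln (gauss_norm n (lam / 2))).
Local Notation g := (gauss_joint_pdf p (lam / 2)).
Local Notation q := (convolution p (gauss_pdf (lam / 2))).

Let mp : measurable_fun setT p. Proof. by case: pP. Qed.
Let p0 x : 0 <= p x. Proof. by case: pP. Qed.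
Let lam2 : 0 < lam / 2. Proof. by rewrite divr_gt0. Qed.
Let mlnp : measurable_fun setT (fun x => ln (p x)).
Proof. exact: measurableT_comp. Qed.

(** A finite second moment prevents the entropy from being [+oo]: comparing [p]
    with the standard Gaussian density [G] through [1 + w <= e^w] at
    [w = ln (G / p)] gives [- ln p <= - ln G + G / p], where [- ln G] grows like
    [|x|^2 / 2] and the [P]-integral of [G / p] is at most 1. *)
Lemma integral_ln_density_neg : (\int[P]_x (EFin \o (fun x => ln (p x)))^\- x < +oo)%E.
Proof.
have [a sa] : exists a, has_mean P (@sqnorm R n) a.
  by apply: ge0_has_mean => //; [exact: measurable_sqnorm|exact: sqnorm_ge0].
pose X (x : Rn R n) := gauss_pdf 1 x * expR (- ln (p x)).
have mX : measurable_fun setT X.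
  apply: measurable_funM; first exact: measurable_gauss_pdf.
  by apply: measurableT_comp => //; exact: measurableT_comp.
have G0 (x : Rn R n) : 0 <= gauss_pdf 1 x by rewrite ltW// gauss_pdf_gt0.
have X0 x : 0 <= X x by rewrite mulr_ge0 ?expR_ge0.
have [b Xb] : exists b, has_mean P X b.
  apply: ge0_has_mean => //.
  apply: le_lt_trans (integral_div_density_le pP _ G0) _.
    exact: measurable_gauss_pdf.
  by rewrite integral_gauss_pdf// ltry.
pose B (x : Rn R n) := `|ln (gauss_norm n 1)| + (2^-1 * sqnorm x + X x).
have [Bi BE] := has_meanD (has_mean_cst P `|ln (gauss_norm n 1)|)
  (has_meanD (has_meanZ 2^-1 sa) Xb).
apply: (@le_lt_trans _ _ (\int[P]_x (B x)%:E)%E); last by rewrite BE ltry.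
apply: ge0_le_integral => //.
- by apply: measurable_funeneg; exact/measurable_EFinP.
- exact: (measurable_int _ Bi).
- move=> x _; rewrite funenegE /= -EFin_max lee_fin ge_max; apply/andP; split.
    have := expR_ge1Dx (ln (gauss_pdf 1 x) - ln (p x)).
    rewrite expRD lnK ?posrE ?gauss_pdf_gt0// -/(X x) ln_gauss_pdf// mulr1 /B.
    by have := ler_norm (ln (gauss_norm n (1 : R))); lra.
  by rewrite addr_ge0// addr_ge0// mulr_ge0 ?sqnorm_ge0.
Qed.

Lemma eot_objectiveE (pi : probability (Rn R n * Rn R n)%type R)
    (f : Rn R n * Rn R n -> R) : is_density mu2 f pi ->
  eot_objective lam f = (\int[pi]_z (sqnorm (tsub z.1 z.2))%:E +
                         lam%:E * \int[pi]_z (ln (f z))%:E)%E.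
Proof.
move=> fpi; have [mf f0 _] := fpi.
rewrite /eot_objective /entropy muleN oppeK (integral_density fpi); last first.
  exact: measurable_sqnorm_tsub.
rewrite (integral_density fpi); last exact: measurableT_comp.
by under [in X in (_ + _ * X)%E]eq_integral do rewrite mulrC.
Qed.

Lemma ln_gauss_joint_pdf z : 0 < p z.1 ->
  ln (g z) = ln (p z.1) - C - lam^-1 * sqnorm (tsub z.1 z.2).
Proof.
move=> pz; rewrite lnM ?posrE ?gauss_pdf_gt0// ln_gauss_pdf// sqnorm_tsubC.
rewrite (_ : 2 * (lam / 2) = lam); last by field.
by rewrite [_ / lam]mulrC addrA.
Qed.

(** The transport cost cancels against the quadratic part of [lam * ln g], which
    is why the value does not involve it. *)
Lemma eot_objective_gauss (Q : probability (Rn R n) R)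
    (pi : probability (Rn R n * Rn R n)%type R) (h : R) :
  is_density mu2 g pi -> is_coupling P Q pi ->
  (\int[Q]_x (sqnorm x)%:E < +oo)%E ->
  has_mean P (fun x => ln (p x)) h ->
  eot_objective lam g = (lam * (h - C))%:E.
Proof.
move=> gpi cpl Qlt Ph.
have [a Da] := has_mean_transport cpl P2P Qlt.
have pih := (has_mean_coupling_fst cpl h mlnp).2 Ph.
have [ri rE] := has_meanD (has_meanD pih (has_mean_cst pi (- C)))
  (has_meanZ (- lam^-1) Da).
have mg : measurable_fun setT g by case: gpi.
rewrite (eot_objectiveE gpi) Da.2.
rewrite (ae_eq_integral
  (fun z => (ln (p z.1) - C - lam^-1 * sqnorm (tsub z.1 z.2))%:E))//.
- under eq_integral do rewrite -mulNr.
  rewrite rE -EFinM -EFinD; congr EFin.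
  by field; rewrite gt_eqF.
- by apply/measurable_EFinP; exact: measurableT_comp.
- by under eq_fun do rewrite -mulNr; exact: (measurable_int _ ri).
- apply: filterS (ae_coupling_fst cpl (ae_density_gt0 pP)) => z pz _.
  by rewrite ln_gauss_joint_pdf.
Qed.

(** The constant [lam * (h - C)] is the value of the Gaussian coupling
    ([eot_objective_gauss]), and the remainder is a lower bound for [lam] times
    the relative entropy, obtained by testing it against [s * \1_A]. *)
Lemma eot_objective_ge (Q Q' : probability (Rn R n) R)
    (pi : probability (Rn R n * Rn R n)%type R) f :
  is_density mu q Q -> is_density mu2 f pi -> is_coupling P Q' pi ->
  (\int[Q']_x (sqnorm x)%:E < +oo)%E ->
  (eot_objective lam f < +oo)%E ->
  exists h, has_mean P (fun x => ln (p x)) h /\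
    forall (A : set (Rn R n)) (s : R), measurable A ->
    ((lam * (h - C) + lam * (s * fine (Q' A) - (expR s - 1) * fine (Q A)))%:E
      <= eot_objective lam f)%E.
Proof.
move=> Qq fpi cpl Q'lt; have [mf f0 _] := fpi.
have [a Da] := has_mean_transport cpl P2P Q'lt.
rewrite (eot_objectiveE fpi) Da.2 => objlt.
have mlnf : measurable_fun setT (fun z => ln (f z)) by exact: measurableT_comp.
have mlnp1 : measurable_fun setT (fun z : Rn R n * Rn R n => ln (p z.1)).
  exact: (measurableT_comp mlnp measurable_fst).
have lnf_lt : (\int[pi]_z (ln (f z))%:E < +oo)%E.
  rewrite ltey; apply/eqP => lnfoo; move: objlt.
  by rewrite lnfoo gt0_muley ?lte_fin// addey.
have lnp_lt : (\int[pi]_z (EFin \o (fun z : Rn R n * Rn R n => ln (p z.1)))^\- z < +oo)%E.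
  rewrite (_ : _^\- = fun z => (EFin \o (fun x => ln (p x)))^\- z.1)%E; last first.
    by apply/funext => z; rewrite !funenegE.
  rewrite (integral_coupling_fst cpl)//; first exact: integral_ln_density_neg.
  by apply: measurable_funeneg; exact/measurable_EFinP.
have mg := measurable_gauss_joint_pdf (lam / 2) pP.
have g0 := gauss_joint_pdf_ge0 lam2 pP.
(* [r] is the bracket [ln phi (y - x) + t + 1 - X] and [b] is the mean of [X]. *)
have key A s : measurable A -> exists r b,
    [/\ has_mean pi r (- C - lam^-1 * a + s * fine (Q' A) + 1 - b),
        b <= 1 + (expR s - 1) * fine (Q A) &
        {ae pi, forall z, ln (p z.1) + r z <= ln (f z)}].
  move=> mA.
  (* [e] is the exponential of the test function [s * \1_A], in a form that is
     linear in the indicator. *)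
  pose e (y : Rn R n) : R := 1 + (expR s - 1) * \1_A y.
  have eE y : e y = expR (s * \1_A y).
    rewrite /e indicE; case: (y \in A); rewrite ?mulr1 ?mulr0 ?expR0; lra.
  have e0 y : 0 <= e y by rewrite eE expR_ge0.
  have me : measurable_fun setT e.
    by apply: measurable_funD => //; apply: measurable_funM.
  have me2 : measurable_fun setT (fun z : Rn R n * Rn R n => e z.2).
    exact: (measurableT_comp me measurable_snd).
  pose X z := e z.2 * g z * expR (- ln (f z)).
  have mX : measurable_fun setT X.
    apply: measurable_funM; first exact: measurable_funM.
    by apply: measurableT_comp => //; exact: measurableT_comp.
  have eg0 z : 0 <= e z.2 * g z by rewrite mulr_ge0.
  have X0 z : 0 <= X z by rewrite mulr_ge0 ?expR_ge0.
  have Xle : (\int[pi]_z (X z)%:E <= (1 + (expR s - 1) * fine (Q A))%:E)%E.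
    apply: le_trans (integral_div_density_le fpi _ eg0) _.
      exact: measurable_funM.
    rewrite (integral_gauss_joint_snd lam2 pP)// -(integral_density Qq)//.
    by rewrite (has_meanD (has_mean_cst Q 1)
      (has_meanZ (expR s - 1) (has_mean_indic Q mA))).2.
  have [b Xb] : exists b, has_mean pi X b.
    by apply: ge0_has_mean => //; apply: le_lt_trans Xle (ltry _).
  pose r z := (- C + (- lam^-1) * sqnorm (tsub z.1 z.2) + s * \1_A z.2 + 1
    + (-1) * X z).
  exists r, b; split.
  - have := has_meanD (has_meanD (has_meanD (has_meanD (has_mean_cst pi (- C))
      (has_meanZ (- lam^-1) Da))
      (has_meanZ s (has_mean_coupling_snd_indic cpl mA))) (has_mean_cst pi 1))
      (has_meanZ (-1) Xb).
    by rewrite mulN1r mulNr.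
  - by move: Xle; rewrite Xb.2 lee_fin.
  - apply: filterS (ae_coupling_fst cpl (ae_density_gt0 pP)) => z pz.
    have gz : 0 < g z by rewrite mulr_gt0// gauss_pdf_gt0.
    have := expR_ge1Dx (s * \1_A z.2 + ln (g z) + (- ln (f z))).
    rewrite !expRD -eE lnK ?posrE// -/(X z) ln_gauss_joint_pdf// /r.
    lra.
(* The trivial test function already gives integrability, hence an [h] that
   depends neither on [A] nor on [s]. *)
have [r [b [[ri rE] _ rle]]] := key set0 0 measurable0.
have [lnpi lnfi _] := integral_sandwich mlnp1 mlnf ri lnp_lt lnf_lt rle.
have [h lnph] := integrable_has_mean lnpi.
have [l lnfl] := integrable_has_mean lnfi.
exists h; split; first exact/(has_mean_coupling_fst cpl h mlnp).
move=> A s mA {r b ri rE rle}.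
have [r [b [[ri rE] ble rle]]] := key A s mA.
have [_ _] := integral_sandwich mlnp1 mlnf ri lnp_lt lnf_lt rle.
rewrite rE lnph.2 lnfl.2 -EFinM -!EFinD !lee_fin => hl.
have : lam * (h - C - lam^-1 * a + s * fine (Q' A) + 1 - b) <= lam * l.
  by rewrite ler_wpM2l ?(ltW lam0)//; move: hl; lra.
have : lam * b <= lam * (1 + (expR s - 1) * fine (Q A)).
  by rewrite ler_wpM2l ?(ltW lam0).
have : lam * (lam^-1 * a) = a by rewrite mulVKf// gt_eqF.
by lra.
Qed.

End eot.

(** * Existence and uniqueness of the minimizer *)

(** The function [(e^s - 1) b - s a] is nonnegative and vanishes at [s = 0], so its
    slope [b - a] there is zero. The proof is derivative-free: for [s < 1], the bound
    [e^s <= 1 / (1 - s)] gives [s a (1 - s) <= s b], and [s] is then taken small and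
    of the sign of [a - b]. *)
Lemma eq_of_expR_tangent (R : realType) (a b : R) : 0 <= a -> 0 <= b ->
  (forall s, s * a <= (expR s - 1) * b) -> a = b.
Proof.
move=> a0 b0 H.
have K s : s < 1 -> s * a * (1 - s) <= s * b.
  move=> s1; have s10 : 0 < 1 - s by rewrite subr_gt0.
  have E : expR s * (1 - s) <= 1.
    rewrite -[leRHS](expRxMexpNx_1 s) ler_wpM2l ?expR_ge0//.
    by have := expR_ge1Dx (- s); lra.
  by have := ler_wpM2r (ltW s10) (H s); have := ler_wpM2r b0 E; lra.
apply/eqP; rewrite eq_le; apply/andP; split; rewrite leNgt; apply/negP => ab.
- have a_gt0 : 0 < a by apply: le_lt_trans ab.
  pose s := (a - b) / (2 * a).
  have s0 : 0 < s by rewrite divr_gt0 ?mulr_gt0 ?subr_gt0.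
  have s1 : s < 1 by rewrite ltr_pdivrMr ?mulr_gt0//; lra.
  have := K s s1; rewrite -mulrA ler_pM2l// mulrBr mulr1.
  have -> : a * s = (a - b) / 2 by rewrite /s; field; rewrite gt_eqF.
  by lra.
- pose u := (b - a) / (2 * b).
  have b_gt0 : 0 < b by apply: le_lt_trans ab.
  have u0 : 0 < u by rewrite divr_gt0 ?mulr_gt0 ?subr_gt0.
  have /K : - u < 1 by lra.
  rewrite opprK -mulrA !mulNr lerN2 ler_pM2l// mulrDr mulr1.
  have : a * u <= b * u by rewrite ler_wpM2r// ltW.
  have -> : b * u = (b - a) / 2 by rewrite /u; field; rewrite gt_eqF.
  by lra.
Qed.

Theorem theorem5p1 (R : realType) (n : nat) (lam : R) (lam_gt0 : 0 < lam)
    (P : probability (Rn R n) R) (hP : P2 P) :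
  exists Q : probability (Rn R n) R,
    [/\ is_eot_argmin lam P Q,
        (forall p : Rn R n -> R, is_density (lebesgue_tuple R n) p P ->
           is_density (lebesgue_tuple R n)
             (convolution p (gauss_pdf (lam / 2))) Q) &
        (forall Q' : probability (Rn R n) R,
           is_eot_argmin lam P Q' -> (eot_cost lam P Q' < +oo)%E ->
           forall A, measurable A -> Q' A = Q A)].
Proof.
have [Pmu P2P] := hP.
have [p pP] := exists_density Pmu.
have lam2 : 0 < lam / 2 by rewrite divr_gt0.
have [Q [pi [Qq gpi cpl]]] := exists_gauss_coupling lam2 pP.
have P2Q := gauss_coupling_P2 lam2 pP Qq P2P.
pose C := ln (gauss_norm n (lam / 2)).
have costQ h : has_mean P (fun x => ln (p x)) h ->
    (eot_cost lam P Q <= (lam * (h - C))%:E)%E.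
  move=> Ph; apply: ereal_inf_lbound; exists pi, (gauss_joint_pdf p (lam / 2)).
  by split => //; rewrite (eot_objective_gauss lam_gt0 P2P pP gpi cpl P2Q.2 Ph).
(* Couplings with objective [+oo] are harmless; any other one makes [ln p]
   integrable, so that [costQ] applies. *)
have argminQ : is_eot_argmin lam P Q.
  split => // Q' [_ Q'lt]; apply: le_ereal_inf_tmp => _ [pi' [f [cpl' fpi' ->]]].
  have [->|] := eqVneq (eot_objective lam f) +oo%E; first by rewrite leey.
  rewrite -ltey => /(eot_objective_ge lam_gt0 P2P pP Qq fpi' cpl' Q'lt).
  move=> [h [/costQ /le_trans le_cost /(_ _ 0 measurable0)]].
  apply: le_trans; rewrite expR0 subrr !mul0r subrr mulr0 addr0.
  exact: le_cost.
exists Q; split => //.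
  (* Both convolutions are the integral of the Gaussian density against [P]. *)
  move=> p' p'P; suff -> : convolution p' (gauss_pdf (lam / 2)) =
    convolution p (gauss_pdf (lam / 2)) by [].
  apply/funext => y.
  have mg : measurable_fun setT (fun x => gauss_pdf (lam / 2) (tsub y x)).
    exact: (measurableT_comp (measurable_gauss_pdf_tsub (lam / 2)) (measurable_pair2 y)).
  rewrite /convolution /Rintegral; congr fine.
  under eq_integral do rewrite mulrC.
  under [RHS]eq_integral do rewrite mulrC.
  by rewrite -(integral_density p'P mg) -(integral_density pP mg).
move=> Q' [P2Q' minQ'] costlt A mA.
have [_ [pi' [f [cpl' fpi' ->]]] flt] := ereal_inf_lt costlt.
have [h [Ph _]] := eot_objective_ge lam_gt0 P2P pP Qq fpi' cpl' P2Q'.2 flt.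
suff E : fine (Q' A) = fine (Q A).
  by rewrite -[LHS]fineK ?fin_num_measure// E fineK ?fin_num_measure.
apply: eq_of_expR_tangent; [exact: fine_ge0|exact: fine_ge0|move=> s].
have : ((lam * (h - C) + lam * (s * fine (Q' A) - (expR s - 1) * fine (Q A)))%:E
   <= (lam * (h - C))%:E)%E.
  apply: le_trans (le_trans (minQ' _ P2Q) (costQ _ Ph)).
  apply: le_ereal_inf_tmp => _ [pi2 [f2 [cpl2 fpi2 ->]]].
  have [->|] := eqVneq (eot_objective lam f2) +oo%E; first by rewrite leey.
  rewrite -ltey => /(eot_objective_ge lam_gt0 P2P pP Qq fpi2 cpl2 P2Q'.2).
  move=> [h2 [Ph2 /(_ _ s mA)]].
  by have [-> ] : h2%:E = h%:E :> \bar R by rewrite -Ph.2 -Ph2.2.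
by rewrite lee_fin gerDl pmulr_rle0// subr_le0.
Qed.
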